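(* Let $(\mathcal{D},\sqsubseteq)$ be a poset. (1) The following are equivalent: (a) for every finite nonempty set $\mathcal{G}$ and every map $\delta:\mathcal{G}\to\mathcal{D}$, $(\mathcal{G},(\mathcal{D},\sqsubseteq),\delta)$ is a pattern multistructure; (b) $(\mathcal{D},\sqsubseteq)$ is a meet-multisemilattice with $\mathcal{D}=\downarrow\max(\mathcal{D})$. (2) The following are equivalent: (a) for every nonempty set $\mathcal{G}$ and every map $\delta:\mathcal{G}\to\mathcal{D}$, $(\mathcal{G},(\mathcal{D},\sqsubseteq),\delta)$ is a pattern multistructure; (b) $(\mathcal{D},\sqsubseteq)$ is a complete meet-multisemilattice.
   Context: For $S\subseteq\mathcal{D}$, $S^\ell=\{x\in\mathcal{D}\mid\forall s\in S,\ x\sqsubseteq s\}$ ($\emptyset^\ell=\mathcal{D}$), $\max(X)$ is the set of maximal elements of $X$, and $\downarrow X=\{y\in\mathcal{D}\mid\exists x\in X,\ y\sqsubseteq x\}$. $S$ has all its multi-infima if $S^\ell=\downarrow\max(S^\ell)$. A meet-multisemilattice is a poset in which every nonempty finite subset has all its multi-infima; a complete meet-multisemilattice is one in which every subset (including $\emptyset$) has all its multi-infima. A pattern setup $(\mathcal{G},(\mathcal{D},\sqsubseteq),\delta)$ ($\mathcal{G}$ a set, $\delta:\mathcal{G}\to\mathcal{D}$) is a pattern multistructure if for every $A\subseteq\mathcal{G}$ the set $\{\delta(g)\mid g\in A\}$ has all its multi-infima, i.e. $cov(A)=\downarrow\max(cov(A))$ where $cov(A)=\{d\in\mathcal{D}\mid\forall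 g\in A,\ d\sqsubseteq\delta(g)\}$. *)

(* Defs.v *)
From mathcomp Require Import all_boot all_order.
From mathcomp Require Import classical_sets cardinality.

Set Implicit Arguments.
Unset Strict Implicit.
Unset Printing Implicit Defensive.

Local Open Scope order_scope.
Local Open Scope classical_set_scope.

(* The lower set [S^l] of [S] is the library's [lbound S] (so that
   [lbound set0 = setT]) and the down-closure of [X] is the library's [down X].
   The carrier of a [porderType] may be empty. *)

Definition maximals (d : Order.disp_t) (D : porderType d) (X : set D) : set D :=
  [set x | X x /\ forall y, X y -> x <= y -> y = x].

Definition has_multi_infima (d : Order.disp_t) (D : porderType d)
    (S : set D) : Prop :=
  lbound S = down (maximals (lbound S)).

Definition meet_multisemilattice (d : Order.disp_t) (D : porderType d) : Prop :=
  forall S : set D, finite_set S -> S !=set0 -> has_multi_infima S.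

Definition complete_meet_multisemilattice (d : Order.disp_t)
    (D : porderType d) : Prop :=
  forall S : set D, has_multi_infima S.

Record pattern_setup (d : Order.disp_t) (D : porderType d) := PatternSetup {
  objects : Type;
  description : objects -> D }.

Definition cov (d : Order.disp_t) (D : porderType d) (P : pattern_setup D)
    (A : set (objects P)) : set D :=
  [set x | forall g, A g -> x <= description g].

Definition pattern_multistructure (d : Order.disp_t) (D : porderType d)
    (P : pattern_setup D) : Prop :=
  forall A : set (objects P), has_multi_infima (@description d D P @` A).

Lemma lbound_description (d : Order.disp_t) (D : porderType d)
    (P : pattern_setup D) (A : set (objects P)) :
  lbound (@description d D P @` A) = cov A.
Proof.
apply/seteqP; split=> x /= xA; first by move=> g Ag; apply: xA; exists g.
by move=> _ [g Ag <-]; apply: xA.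
Qed.

Lemma pattern_multistructureE (d : Order.disp_t) (D : porderType d)
    (P : pattern_setup D) :
  pattern_multistructure P <->
  forall A : set (objects P), cov A = down (maximals (cov A)).
Proof.
by split=> h A; move: (h A); rewrite /has_multi_infima lbound_description.
Qed.

(* Main.v *)
Require Import Defs.
From mathcomp Require Import all_boot all_order.
From mathcomp Require Import boolp classical_sets cardinality.

Local Open Scope classical_set_scope.

(* A nonempty S is the description image of the setup whose objects are the
   elements of S, described by the inclusion.  The condition D = down (max D) is
   the case S = empty, reached inside a one-object setup by taking A = empty;
   such a setup needs a point of D, but for empty D the condition is vacuous. *)

Lemma has_multi_infima0 (d : Order.disp_t) (D : porderType d) :
  has_multi_infima (@set0 D) <-> [set: D] = down (maximals [set: D]).
Proof.
rewrite /has_multi_infima (_ : lbound set0 = setT) //.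
by apply/seteqP; split=> // x _ y [].
Qed.

Lemma has_multi_infima_subtype (d : Order.disp_t) (D : porderType d)
    (S : set D) :
  pattern_multistructure (PatternSetup (fun x : S => val x)) ->
  has_multi_infima S.
Proof.
move=> /(_ setT) /=; suff -> : [set val x | x in [set: S]] = S by [].
apply/seteqP; split=> [_ [x _ <-]|x Sx]; first exact: set_valP.
by exists (SigSub (mem_set Sx)).
Qed.

(** Without points, any two subsets of [D] coincide. *)
Lemma has_multi_infima_empty (d : Order.disp_t) (D : porderType d) (S : set D) :
  ~ ([set: D] !=set0) -> has_multi_infima S.
Proof. by move=> D0; apply/seteqP; split=> x; case: D0; exists x. Qed.

Theorem theorem7p7 (d : Order.disp_t) (D : porderType d) :
  ((forall (G : Type) (delta : G -> D),
      finite_set [set: G] -> [set: G] !=set0 ->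
      pattern_multistructure (PatternSetup delta))
   <-> (meet_multisemilattice D /\ [set: D] = down (maximals [set: D])))
  /\
  ((forall (G : Type) (delta : G -> D),
      [set: G] !=set0 ->
      pattern_multistructure (PatternSetup delta))
   <-> complete_meet_multisemilattice D).
Proof.
(* Setups over [unit] are both finite and nonempty, so [inf0] serves both equivalences. *)
have inf0 : (forall x : D,
    pattern_multistructure (PatternSetup (fun _ : unit => x))) ->
    has_multi_infima (@set0 D).
  move=> pmD; have [[x _]|D0] := pselect ([set: D] !=set0).
    by have := pmD x set0; rewrite image_set0.
  exact: has_multi_infima_empty.
have subtype_nonempty (S : set D) : S !=set0 -> [set: S] !=set0.
  by move=> [x Sx]; exists (SigSub (mem_set Sx)).
split; split.
- move=> pmD; split.
    move=> S finS /subtype_nonempty S0; apply: has_multi_infima_subtype.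
    (* The type of elements of [S] is equipotent to [S], so finiteness carries over. *)
    by apply: pmD => //; rewrite (eq_finite_set (card_setT S)).
  apply/has_multi_infima0/inf0 => x.
  by apply: pmD; [exact: finite_finset|exists tt].
- move=> [mmD /has_multi_infima0 mi0] G delta finG _ A.
  (* [A] may be empty although [G] is not; [mmD] covers only nonempty images, so this case rests on
     [mi0]. *)
  have [->|A0] := eqVneq A set0; first by rewrite image_set0.
  apply: mmD; first exact/finite_image/(sub_finite_set _ finG).
  by apply: image_nonempty; exact/set0P.
(* For empty [S] the subtype setup has no objects and [pmD] cannot be applied to it. *)
- move=> pmD S; have [->|/set0P/subtype_nonempty S0] := eqVneq S set0.
    by apply: inf0 => x; apply: pmD; exists tt.
  exact/has_multi_infima_subtype/pmD.
- by move=> cD G delta _ A; apply: cD.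
Qed.
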